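(* An irreflexive tournament $T$ is strongly chordal if and only if $T$ contains none of the six tournaments $T_1,\dots,T_6$ described below as an induced subtournament.
   Context: An irreflexive tournament is a loopless digraph in which for every two distinct vertices exactly one of the two possible arcs is present. A digraph is strongly chordal if its vertices can be ordered $v_1,\dots,v_n$ so that for all $i<j$ and $k<\ell$ ($i,j,k,\ell$ not necessarily all distinct), if $v_iv_k, v_iv_\ell, v_jv_k$ are arcs then $v_jv_\ell$ is an arc; equivalently, its adjacency matrix admits a simultaneous row and column permutation with no submatrix $\begin{pmatrix}1&1\\1&0\end{pmatrix}$. The tournaments (all irreflexive, arcs written $a\to b$): $T_1$ on $\{0,1,2,3,4\}$: $0\to1,0\to2,0\to3,1\to2,1\to3,2\to3,2\to4,3\to4,4\to0,4\to1$. $T_2$ on $\{0,\dots,4\}$: $0\to1,0\to4,1\to2,1\to4,2\to0,2\to4,3\to0,3\to1,3\to2,4\to3$. $T_3$ on $\{0,\dots,4\}$: $i\to i+1$ and $i\to i+2$ for all $i$ (indices mod $5$). $T_4$ on $\{0,\dots,4\}$: $0\to1,0\to2,0\to3,1\to2,1\to3,1\to4,2\to3,3\to4,4\to0,4\to2$. $T_5$ on $\{0,\dots,4\}$: $0\to1,0\to2,0\to3,1\to2,1\to4,2\to3,3\to1,3\to4,4\to0,4\to2$. $T_6$: two disjoint directed $3$-cycles $a_1\to a_2\to a_3\to a_1$ and $b_1\to b_2\to b_3\to b_1$, together with all arcs $a_i\to b_j$. *)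

(* Defs.v *)
From mathcomp Require Import all_boot.

Set Implicit Arguments.
Unset Strict Implicit.
Unset Printing Implicit Defensive.

Definition irreflexive_tournament (V : finType) (arc : rel V) : Prop :=
  irreflexive arc /\ forall x y : V, x != y -> arc x y (+) arc y x.

(* The indices i, j, k, l below may coincide, except as excluded by i < j
   and k < l. *)
Definition strongly_chordal (V : finType) (arc : rel V) : Prop :=
  exists v : 'I_#|V| -> V, bijective v /\
    forall i j k l : 'I_#|V|, i < j -> k < l ->
      arc (v i) (v k) -> arc (v i) (v l) -> arc (v j) (v k) ->
      arc (v j) (v l).

(* The image of f induces a subdigraph of arc isomorphic to pat. *)
Definition contains_induced (V U : finType) (arc : rel V) (pat : rel U) : Prop :=
  exists f : U -> V, injective f /\ forall x y : U, arc (f x) (f y) = pat x y.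

Definition digraph5 (arcs : seq (nat * nat)) : rel 'I_5 :=
  fun i j => (i : nat, j : nat) \in arcs.

Definition T1 : rel 'I_5 := digraph5
  [:: (0, 1); (0, 2); (0, 3); (1, 2); (1, 3);
      (2, 3); (2, 4); (3, 4); (4, 0); (4, 1)].

Definition T2 : rel 'I_5 := digraph5
  [:: (0, 1); (0, 4); (1, 2); (1, 4); (2, 0);
      (2, 4); (3, 0); (3, 1); (3, 2); (4, 3)].

Definition T3 : rel 'I_5 :=
  fun i j => (j == i + 1 %[mod 5]) || (j == i + 2 %[mod 5]).

Definition T4 : rel 'I_5 := digraph5
  [:: (0, 1); (0, 2); (0, 3); (1, 2); (1, 3);
      (1, 4); (2, 3); (3, 4); (4, 0); (4, 2)].

Definition T5 : rel 'I_5 := digraph5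
  [:: (0, 1); (0, 2); (0, 3); (1, 2); (1, 4);
      (2, 3); (3, 1); (3, 4); (4, 0); (4, 2)].

(* inl indexes the cycle a_1 a_2 a_3 and inr the cycle b_1 b_2 b_3, with
   indices shifted to 0, 1, 2. *)
Definition T6 : rel ('I_3 + 'I_3) := fun x y =>
  match x, y with
  | inl i, inl j | inr i, inr j => j == i + 1 %[mod 3]
  | inl _, inr _ => true
  | inr _, inl _ => false
  end.

(* Main.v *)
(** The excluded tournaments are rejected by trying every ordering of their
    vertices. Conversely, suppose that T contains none of them. Two directed
    3-cycles with exactly one common vertex span one of T_1, ..., T_5. If two
    3-cycles are disjoint, then either some 3-cycle takes two vertices of one
    and one of the other, which is the previous situation, or one of them
    dominates the other, which gives T_6. So any two 3-cycles share an arc, and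
    since four vertices carry at most two 3-cycles, all 3-cycles share an arc
    q -> p. Reversing q -> p leaves no 3-cycle, hence a transitive tournament.
    Listing its vertices from sink to source, except that those below q are
    moved to the end in the opposite order, is a strongly chordal ordering
    of T. *)
Require Import Defs.
From mathcomp Require Import all_boot zify.

Set Implicit Arguments.
Unset Strict Implicit.
Unset Printing Implicit Defensive.

(** * Orderings as injective rank functions *)

Definition gamma_free_rank (U : Type) (arc : rel U) (r : U -> nat) : Prop :=
  forall i j k l : U, r i < r j -> r k < r l ->
    arc i k -> arc i l -> arc j k -> arc j l.

Lemma sorted_rank (U : eqType) (r : U -> nat) (s : seq U) :
  injective r -> uniq s -> sorted ltn (map r (sort (relpre r leq) s)).
Proof.
move=> rI us; rewrite ltn_sorted_uniq_leq map_inj_uniq // sort_uniq us /=.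
by rewrite sorted_map sort_sorted // => x y; apply: leq_total.
Qed.

Lemma ltn_rank_nth (U : eqType) (r : U -> nat) (s : seq U) (x0 : U) i j :
  sorted ltn (map r s) -> i < j -> j < size s ->
  r (nth x0 s i) < r (nth x0 s j).
Proof.
move=> ss ij js; rewrite -!(nth_map x0 0) ?(ltn_trans ij) //.
apply: (sorted_ltn_nth ltn_trans) => //;
  by rewrite inE size_map ?(ltn_trans ij).
Qed.

(** A rank can be given by a formula and pulled back along an embedding; sorting by rank recovers
    the positions in ['I_#|V|]. *)
Lemma strongly_chordalP (V : finType) (arc : rel V) :
  strongly_chordal arc <->
  exists r : V -> nat, injective r /\ gamma_free_rank arc r.
Proof.
split=> [[v [[w vK wK] vG]]|[r [rI rG]]].
  exists (fun x => w x : nat); split=> [x y /val_inj /(can_inj wK) //|].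
  by move=> i j k l ij kl; rewrite -(wK i) -(wK j) -(wK k) -(wK l); apply: vG.
set s := sort (relpre r leq) (enum V).
have szs : size s = #|V| by rewrite size_sort -cardE.
have ss : sorted ltn (map r s) by apply: sorted_rank rI (enum_uniq _).
(* Only an index supplies an element of [V], so the default of [nth] depends on [i]; it is never
   reached. *)
pose v (i : 'I_#|V|) := nth (enum_val i) s i.
have vr (i j : 'I_#|V|) : i < j -> r (v i) < r (v j).
  move=> ij; rewrite /v (set_nth_default (enum_val j)) ?szs //.
  by apply: ltn_rank_nth => //; rewrite szs.
exists v; split; last by move=> i j k l /vr ij /vr kl; apply: rG.
apply: inj_card_bij; last by rewrite card_ord.
move=> i j vij; apply: val_inj; case: (ltngtP i j) => // /vr;
  by rewrite vij ltnn.
Qed.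

(** * The six tournaments are not strongly chordal *)

Definition gamma_free_seq (U : Type) (arc : rel U) (s : seq U) : bool :=
  if s is x0 :: _ then
    let a i j := arc (nth x0 s i) (nth x0 s j) in
    let ps := [seq (i, j) | j <- iota 0 (size s), i <- iota 0 j] in
    all (fun ij => all (fun kl =>
      [&& a ij.1 kl.1, a ij.1 kl.2 & a ij.2 kl.1] ==> a ij.2 kl.2) ps) ps
  else true.

Lemma rank_gamma_free_seq (U : eqType) (arc : rel U)
    (r : U -> nat) (s : seq U) :
  gamma_free_rank arc r -> sorted ltn (map r s) -> gamma_free_seq arc s.
Proof.
case: s => // x0 s' rG; set s := x0 :: s' => ss; rewrite /gamma_free_seq -/s.
have inP i j : i \in iota 0 j -> i < j by rewrite mem_iota.
apply/allP=> _ /allpairsPdep[j [i [/inP js /inP ij ->]]].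
apply/allP=> _ /allpairsPdep[l [k [/inP ls /inP kl ->]]].
by apply/implyP=> /and3P[]; apply: rG; apply: ltn_rank_nth.
Qed.

(** The rank on [V] pulls back along the embedding, and sorting [s] by it would give a permutation
    that passes the test. *)
Lemma permutations_not_strongly_chordal (U V : finType) (pat : rel U)
    (arc : rel V) (s : seq U) :
  uniq s -> ~~ has (gamma_free_seq pat) (permutations s) ->
  strongly_chordal arc -> ~ contains_induced arc pat.
Proof.
move=> us /negP hs /strongly_chordalP[r [rI rG]] [f [fI fP]]; apply: hs.
have rfI := inj_comp rI fI.
apply/hasP; exists (sort (relpre (r \o f) leq) s).
  by rewrite mem_permutations perm_sort.
apply: (rank_gamma_free_seq (r := r \o f)); last exact: sorted_rank.
by move=> i j k l ij kl; rewrite -!fP; apply: rG.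
Qed.

(* [enum 'I_n] does not reduce to explicit ordinals, this list does. *)
Definition ords5 : seq 'I_5 :=
  [:: @Ordinal 5 0 isT; @Ordinal 5 1 isT; @Ordinal 5 2 isT;
      @Ordinal 5 3 isT; @Ordinal 5 4 isT].

Definition ords33 : seq ('I_3 + 'I_3) :=
  let o := [:: @Ordinal 3 0 isT; @Ordinal 3 1 isT; @Ordinal 3 2 isT] in
  map inl o ++ map inr o.

Lemma mem_ords5 i : i \in ords5.
Proof. by case: i => [[|[|[|[|[|?]]]]] ?]. Qed.

Definition avoids (V : finType) (T : rel V) : Prop :=
  ~ contains_induced T T1 /\ ~ contains_induced T T2 /\
  ~ contains_induced T T3 /\ ~ contains_induced T T4 /\
  ~ contains_induced T T5 /\ ~ contains_induced T T6.

Lemma strongly_chordal_avoids (V : finType) (T : rel V) :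
  strongly_chordal T -> avoids T.
Proof.
move=> sT; rewrite /avoids; do !split; move: sT;
  [apply: (@permutations_not_strongly_chordal _ _ _ _ ords5)..|
   apply: (@permutations_not_strongly_chordal _ _ _ _ ords33)];
  by vm_compute.
Qed.

(** * Two 3-cycles with exactly one common vertex *)

Lemma contains_induced_trans (U V W : finType)
    (r : rel U) (s : rel V) (t : rel W) :
  contains_induced r s -> contains_induced s t -> contains_induced r t.
Proof.
move=> [f [fI fP]] [g [gI gP]]; exists (f \o g).
by split=> [|x y] /=; [apply: inj_comp | rewrite fP].
Qed.

(** Injectivity is automatic: two adjacent vertices with the same image would produce a loop. *)
Lemma contains_semicomplete (U V : finType)
    (arc : rel V) (pat : rel U) (f : U -> V) :
  irreflexive arc -> (forall x y, x != y -> pat x y || pat y x) ->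
  (forall x y, arc (f x) (f y) = pat x y) -> contains_induced arc pat.
Proof.
move=> irr tot fP; exists f; split=> // x y fxy.
by apply: contraTeq isT => /tot; rewrite -!fP fxy irr.
Qed.

Lemma tournament_neq (V : finType) (T : rel V) x y :
  irreflexive_tournament T -> T x y -> x <> y.
Proof. by move=> [irr _] xy e; rewrite e irr in xy. Qed.

Lemma tournament_asym (V : finType) (T : rel V) x y :
  irreflexive_tournament T -> T x y -> T y x = false.
Proof.
move=> hT xy; have /eqP xNy := tournament_neq hT xy.
by move: (hT.2 _ _ xNy); rewrite xy; case: (T y x).
Qed.

Lemma tournament_total (V : finType) (T : rel V) x y :
  irreflexive_tournament T -> x != y -> T y x = ~~ T x y.
Proof. by move=> [_ tot] /tot; case: (T x y); case: (T y x). Qed.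

(** The 3-cycles 0 1 2 and 0 3 4 share the vertex 0; the booleans orient the four remaining
    pairs. *)
Definition bowtie (b1 b2 b3 b4 : bool) : rel 'I_5 := digraph5
  [:: (0, 1); (1, 2); (2, 0); (0, 3); (3, 4); (4, 0);
      if b1 then (1, 3) else (3, 1); if b2 then (1, 4) else (4, 1);
      if b3 then (2, 3) else (3, 2); if b4 then (2, 4) else (4, 2)].

Definition embeds5 (r s : rel 'I_5) (p : seq 'I_5) : bool :=
  all (fun i : 'I_5 => all (fun j : 'I_5 =>
    r (nth i p i) (nth j p j) == s i j) ords5) ords5.

Lemma embeds5_contains (r s : rel 'I_5) :
  irreflexive r -> (forall x y, x != y -> s x y || s y x) ->
  has (embeds5 r s) (permutations ords5) -> contains_induced r s.
Proof.
move=> irr tot /hasP[p _ /allP pP].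
apply: (@contains_semicomplete _ _ _ _ (fun i : 'I_5 => nth i p i)) => // i j.
by apply/eqP; apply: (allP (pP i (mem_ords5 i))); apply: mem_ords5.
Qed.

Lemma semicomplete5 (s : rel 'I_5) :
  all (fun i => all (fun j => (i == j) || s i j || s j i) ords5) ords5 ->
  forall x y, x != y -> s x y || s y x.
Proof.
move=> /allP h x y /negPf xy.
by have /allP/(_ y (mem_ords5 y)) := h x (mem_ords5 x); rewrite xy.
Qed.

Lemma irreflexive5 (s : rel 'I_5) :
  all (fun i => ~~ s i i) ords5 -> irreflexive s.
Proof. by move=> /allP h x; apply/negbTE/h/mem_ords5. Qed.

Lemma bowtie_contains b1 b2 b3 b4 :
  exists2 n, n < 5 &
    contains_induced (bowtie b1 b2 b3 b4) (nth T1 [:: T1; T2; T3; T4; T5] n).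
Proof.
have irr : irreflexive (bowtie b1 b2 b3 b4).
  by apply: irreflexive5; case: b1; case: b2; case: b3; case: b4.
have : has (fun s => has (embeds5 (bowtie b1 b2 b3 b4) s) (permutations ords5))
         [:: T1; T2; T3; T4; T5].
  (* For each of the 16 orientations, evaluation finds a relabelling that matches one of the five
     patterns. *)
  by case: b1 {irr}; case: b2; case: b3; case: b4; vm_compute.
move=> /(has_nthP T1)[n n5 emb]; exists n => //.
apply: embeds5_contains emb => //.
by apply: semicomplete5; move: n n5 => [|[|[|[|[|]]]]] //; vm_compute.
Qed.

Definition cyc3 (V : Type) (T : rel V) (x y z : V) := [&& T x y, T y z & T z x].

Lemma cyc3_rot (V : Type) (T : rel V) x y z : cyc3 T x y z -> cyc3 T y z x.
Proof. by case/and3P=> xy yz zx; apply/and3P. Qed.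

Lemma bowtie_avoided (V : finType) (T : rel V) x a b c d :
  irreflexive_tournament T -> avoids T ->
  cyc3 T x a b -> cyc3 T x c d -> a = c \/ b = d.
Proof.
move=> hT [h1 [h2 [h3 [h4 [h5 _]]]]] /and3P[xa ab bx] /and3P[xc cd dx].
case: (eqVneq a c) => [|ac]; first by left.
case: (eqVneq b d) => [|bd]; [by right | exfalso].
(* Out-neighbours [a], [c] of [x] differ from its in-neighbours [b], [d]. *)
have ad : a != d by apply: contraTneq xa => ->; rewrite (tournament_asym hT dx).
have bc : b != c by apply: contraTneq bx => ->; rewrite (tournament_asym hT xc).
have h : contains_induced T (bowtie (T a c) (T a d) (T b c) (T b d)).
  apply: (@contains_semicomplete _ _ _ _
    (fun i : 'I_5 => nth x [:: x; a; b; c; d] i)).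
  - exact: hT.1.
  - by apply: semicomplete5;
      case: (T a c); case: (T a d); case: (T b c); case: (T b d).
  - have asym := fun u v => @tournament_asym V T u v hT.
    have tot := fun u v => @tournament_total V T u v hT.
    move=> [[|[|[|[|[|?]]]]] ?] [[|[|[|[|[|?]]]]] ?] //=;
    rewrite /bowtie /digraph5 /= ?hT.1 ?xa ?ab ?bx ?xc ?cd ?dx
     ?(asym _ _ xa) ?(asym _ _ ab) ?(asym _ _ bx) ?(asym _ _ xc) ?(asym _ _ cd)
     ?(asym _ _ dx) ?(tot _ _ ac) ?(tot _ _ ad) ?(tot _ _ bc) ?(tot _ _ bd);
    by case: (T a c); case: (T a d); case: (T b c); case: (T b d).
have [n n5 /(contains_induced_trans h)] :=
  bowtie_contains (T a c) (T a d) (T b c) (T b d).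
by move: n n5 => [|[|[|[|[|]]]]].
Qed.

(** * Disjoint 3-cycles *)

Lemma cyc3_dominated (V : finType) (T : rel V) x y z x' y' z' :
  irreflexive_tournament T -> avoids T ->
  cyc3 T x y z -> cyc3 T x' y' z' ->
  x != y' -> y != x' -> y != z' -> T x' x -> T x' y.
Proof.
move=> hT fT xyz xyz' xy' yx' yz' x'x.
rewrite (tournament_total hT yx'); apply/negP=> yx'T.
(* With the arc from [y] to [x'], a 3-cycle through [x'] arises that contradicts
   [bowtie_avoided]. *)
have c : cyc3 T x' x y by rewrite /cyc3 x'x yx'T andbT; case/and3P: xyz.
by case: (bowtie_avoided hT fT c xyz') => /eqP; apply/negP.
Qed.

Lemma cyc3_meet (V : finType) (T : rel V) x y z x' y' z' :
  irreflexive_tournament T -> avoids T ->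
  cyc3 T x y z -> cyc3 T x' y' z' -> has (mem [:: x'; y'; z']) [:: x; y; z].
Proof.
move=> hT fT; wlog x'x : x y z x' y' z' / T x x'.
  move=> wl c c'; case: (boolP (T x x')) => [/wl|xNx']; first exact.
  case: (eqVneq x x') => [->|xx']; first by rewrite /= !inE eqxx.
  by rewrite has_sym; apply: wl c' c; rewrite (tournament_total hT xx').
move=> c c'; apply: contraT => disj.
have neq u u' : u \in [:: x; y; z] -> u' \in [:: x'; y'; z'] -> u != u'.
  move=> ux u'x'; apply: contraNneq disj => e.
  by apply/hasP; exists u; rewrite //= e.
have c1 := cyc3_rot c; have c2 := cyc3_rot c1.
have c1' := cyc3_rot c'; have c2' := cyc3_rot c1'.
(* An arc from [x'] to [y] would propagate along the cycle to [z] and then to [x], against [x'x]. *)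
have yx' : T y x'.
  rewrite (tournament_total hT) 1?eq_sym ?neq ?inE ?eqxx ?orbT //.
  apply/negP=> x'y.
  have x'z : T x' z by apply: (cyc3_dominated hT fT c1 c' _ _ _ x'y);
    rewrite // neq ?inE ?eqxx ?orbT.
  have : T x' x by apply: (cyc3_dominated hT fT c2 c' _ _ _ x'z);
    rewrite // neq ?inE ?eqxx ?orbT.
  by rewrite (tournament_asym hT x'x).
have zx' : T z x'.
  rewrite (tournament_total hT) 1?eq_sym ?neq ?inE ?eqxx ?orbT //.
  apply/negP=> x'z.
  have : T x' x by apply: (cyc3_dominated hT fT c2 c' _ _ _ x'z);
    rewrite // neq ?inE ?eqxx ?orbT.
  by rewrite (tournament_asym hT x'x).
(* The same propagation with the cycles exchanged: the arc from [u] to [x'] spreads to [y'], then to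
   [z']. *)
have dom u v w : cyc3 T u v w -> {subset [:: u; v; w] <= [:: x; y; z]} ->
    T u x' -> T u y' /\ T u z'.
  move=> d su ux'.
  have neq' t t' : t \in [:: u; v; w] -> t' \in [:: x'; y'; z'] -> t' != t.
    by move=> /su tx t'x'; rewrite eq_sym neq.
  have uy' : T u y'.
    by apply: (cyc3_dominated hT fT c' d _ _ _ ux');
      rewrite neq' ?inE ?eqxx ?orbT.
  split=> //.
  by apply: (cyc3_dominated hT fT c1' d _ _ _ uy');
    rewrite neq' ?inE ?eqxx ?orbT.
have [xy' xz'] : T x y' /\ T x z' by apply: dom c _ x'x.
have [yy' yz'] : T y y' /\ T y z'.
  by apply: dom c1 _ yx' => t; rewrite !inE => /or3P[] ->; rewrite ?orbT.
have [zy' zz'] : T z y' /\ T z z'.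
  by apply: dom c2 _ zx' => t; rewrite !inE => /or3P[] ->; rewrite ?orbT.
have asym := fun u v => @tournament_asym V T u v hT.
pose f (u : 'I_3 + 'I_3) := match u with
  inl i => nth x [:: x; y; z] i | inr i => nth x [:: x'; y'; z'] i end.
case: fT => _ [_ [_ [_ [_ []]]]].
apply: (@contains_semicomplete _ _ _ _ f hT.1).
  by move=> [[[|[|[|?]]] ?]|[[|[|[|?]]] ?]] [[[|[|[|?]]] ?]|[[|[|[|?]]] ?]].
have [/and3P[xy yz zx] /and3P[x'y' y'z' z'x']] := (c, c').
move=> [[[|[|[|?]]] ?]|[[|[|[|?]]] ?]] [[[|[|[|?]]] ?]|[[|[|[|?]]] ?]] //=;
  by [rewrite hT.1 | | rewrite asym].
Qed.

(** * Common arcs of 3-cycles *)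

Lemma cyc3_share (V : finType) (T : rel V) x y z x' y' z' :
  irreflexive_tournament T -> avoids T ->
  cyc3 T x y z -> cyc3 T x' y' z' ->
  has (mem [:: (x', y'); (y', z'); (z', x')]) [:: (x, y); (y, z); (z, x)].
Proof.
move=> hT fT c c'.
have c1 := cyc3_rot c; have c2 := cyc3_rot c1.
have c1' := cyc3_rot c'; have c2' := cyc3_rot c1'.
have share u v w u' v' w' : cyc3 T u v w -> cyc3 T u' v' w' -> u = u' ->
    v = v' \/ w = w'.
  by move=> d d' uu'; rewrite -uu' in d'; apply: bowtie_avoided d d'.
have := cyc3_meet hT fT c c'; rewrite /= !inE !xpair_eqE orbF.
(* Once both cycles are rotated to start at the common vertex, their second or their third vertices
   agree, which gives an arc. *)
by case/or3P => /or3P[] /eqP e;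
  [case: (share _ _ _ _ _ _ c c' e)|case: (share _ _ _ _ _ _ c c1' e)
  |case: (share _ _ _ _ _ _ c c2' e)|case: (share _ _ _ _ _ _ c1 c' e)
  |case: (share _ _ _ _ _ _ c1 c1' e)|case: (share _ _ _ _ _ _ c1 c2' e)
  |case: (share _ _ _ _ _ _ c2 c' e)|case: (share _ _ _ _ _ _ c2 c1' e)
  |case: (share _ _ _ _ _ _ c2 c2' e)] => f; rewrite e f !eqxx ?orbT.
Qed.

(** A 3-cycle avoiding the arc [a b] would need one of [b c], [c a] and one of [b d], [d a]. Such a
    pair gives a vertex two successors or two predecessors, or spans four vertices. *)
Lemma two_cyc3_share_arc (V : finType) (T : rel V) a b c d :
  irreflexive_tournament T -> avoids T ->
  cyc3 T a b c -> cyc3 T a b d -> c != d ->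
  forall x y z, cyc3 T x y z -> (a, b) \in [:: (x, y); (y, z); (z, x)].
Proof.
move=> hT fT c1 c2 /eqP cd x y z c3.
have neq := fun u v => @tournament_neq V T u v hT.
have [/and3P[/neq ab /neq bc /neq ca] /and3P[_ /neq bd /neq da]] := (c1, c2).
have := cyc3_share hT fT c1 c3; have := cyc3_share hT fT c2 c3.
rewrite /= !inE !orbF => /or3P[] /or3P[] /eqP e /or3P[] /or3P[] /eqP f;
  first [congruence | by rewrite ?e ?f ?eqxx ?orbT].
Qed.

(** * Transitive tournaments and the reversal of an arc *)

Lemma acyclic_rank (V : finType) (T : rel V) :
  irreflexive_tournament T -> (forall x y z, ~~ cyc3 T x y z) ->
  exists r : V -> nat, injective r /\ forall x y, T x y = (r y < r x).
Proof.
(* The rank is the out-degree: without 3-cycles, an arc makes out-neighbourhoods strictly nested. *)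
move=> hT nc; pose r x := #|[set y | T x y]|.
have rlt x y : T x y -> r y < r x.
  move=> xy; apply: proper_card; apply/properP; split; last first.
    by exists y; rewrite !inE ?xy // hT.1.
  apply/subsetP=> z; rewrite !inE => yz; apply: contraT => xz.
  case: (eqVneq x z) => [xz'|/(tournament_total hT)].
    by rewrite -xz' (tournament_asym hT xy) in yz.
  by rewrite xz => zx; case/negP: (nc x y z); apply/and3P.
exists r; split=> x y.
  move=> rxy; apply: contraTeq isT => xNy.
  have := tournament_total hT xNy; case: (boolP (T x y)) => [/rlt|_ /rlt];
    by rewrite rxy ltnn.
apply/idP/idP=> [/rlt //|yx]; apply: contraLR yx => xy; rewrite -leqNgt.
case: (eqVneq x y) => [-> //|/(tournament_total hT)].
by rewrite xy => /rlt /ltnW.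
Qed.

Definition flip (V : eqType) (T : rel V) (p q : V) : rel V := fun x y =>
  if (x, y) == (q, p) then false else if (x, y) == (p, q) then true else T x y.

Lemma flip_tournament (V : finType) (T : rel V) p q :
  irreflexive_tournament T -> p != q -> irreflexive_tournament (flip T p q).
Proof.
move=> [irr tot] pq; split=> [x|x y xy]; rewrite /flip !xpair_eqE.
  case: (eqVneq x q) => [->|_];
    by rewrite ?[q == p]eq_sym ?(negPf pq) ?andbF ?irr.
have := tot x y xy; case: (eqVneq x q) => [xq|_]; case: (eqVneq y p) => [yp|_];
  case: (eqVneq x p) => [xp|_]; case: (eqVneq y q) => [yq|_] //=; subst;
  by rewrite eqxx in pq xy *.
Qed.

Lemma flip_acyclic (V : finType) (T : rel V) p q m :
  irreflexive_tournament T -> cyc3 T q p m ->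
  (forall x y z, cyc3 T x y z -> (q, p) \in [:: (x, y); (y, z); (z, x)]) ->
  forall x y z, ~~ cyc3 (flip T p q) x y z.
Proof.
move=> hT /and3P[qp pm mq] all_qp.
have neq := fun u v => @tournament_neq V T u v hT.
(* A 3-cycle using the new arc from [p] to [q] needs such a [z]. But then [z m q] or [z p m] is a
   3-cycle of [T] missing [q p]. *)
have between z : T q z -> T z p -> False.
  move=> qz zp.
  have [[zNq zNp] mNq] := (nesym (neq _ _ qz), neq _ _ zp, neq _ _ mq).
  case: (eqVneq z m) => [zm|/(tournament_total hT)].
    by rewrite zm (tournament_asym hT pm) in zp.
  case: (boolP (T z m)) => [zm _|_ mz].
    have := all_qp z m q; rewrite /cyc3 zm mq qz => /(_ isT).
    by rewrite !inE => /or3P[] /eqP e; congruence.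
  have := all_qp z p m; rewrite /cyc3 zp pm mz => /(_ isT).
  by rewrite !inE => /or3P[] /eqP e; congruence.
have flipP u v : flip T p q u v ->
    (u, v) = (p, q) \/ T u v /\ (q, p) <> (u, v).
  rewrite /flip; case: eqP => // qpN; case: eqP => [|_ uv]; first by left.
  by right; split=> // /esym.
have pNq := nesym (neq _ _ qp).
move=> x y z; apply/negP=> /and3P[].
move=> /flipP[[? ?]|[xy ?]] /flipP[[? ?]|[yz ?]] /flipP[[? ?]|[zx ?]]; subst;
  try congruence.
- exact: between yz zx.
- exact: between zx xy.
- exact: between xy yz.
have := all_qp x y z; rewrite /cyc3 xy yz zx => /(_ isT).
by rewrite !inE => /or3P[] /eqP.
Qed.

(** * The strongly chordal ordering *)

Lemma flipped_strongly_chordal (V : finType) (T : rel V) (r : V -> nat) p q :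
  irreflexive_tournament T -> injective r -> r q < r p -> T q p ->
  (forall x y, flip T p q x y = (r y < r x)) -> strongly_chordal T.
Proof.
move=> hT rI rqp qp rT.
(* Arcs become rank comparisons, which [lia] can treat. *)
have TE x y : T x y = (r x == r q) && (r y == r p) ||
    ~~ ((r x == r p) && (r y == r q)) && (r y < r x).
  rewrite !(inj_eq rI) -!xpair_eqE -rT /flip; case: eqP => [[-> ->] //|_].
  by case: eqP => [[-> ->]|//]; rewrite (tournament_asym hT qp).
apply/strongly_chordalP; pose M := \max_x r x.
have rM x : r x <= M by apply: leq_bigmax.
(* Adding the maximum [M] moves the vertices below [q] past all others; subtracting [r x] reverses
   them. *)
exists (fun x => if r x < r q then M + (r q - r x) else r x); split.
  move=> x y; have := rM x; have := rM y => ? ? e; apply: rI.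
  by move: e; case: ifP; case: ifP; lia.
move=> i j k l; rewrite !TE.
have := rM i; have := rM j; have := rM k; have := rM l.
(* If [j] is moved, its out-neighbours are exactly the later vertices. Otherwise [i] is unmoved too,
   and a moved [l] is dominated by [j]. If [k] and [l] are unmoved, [i] is not [q], whose only
   unmoved out-neighbour is [p]; so [r l < r i < r j], and [l] is not [q], which comes first. *)
move: rqp; case: ifP; case: ifP; case: ifP; case: ifP; lia.
Qed.

(** * Choice of the arc to reverse, and the equivalence *)

Lemma cyc3_common_arc (V : finType) (T : rel V) a b c :
  irreflexive_tournament T -> avoids T -> cyc3 T a b c ->
  exists q p m, cyc3 T q p m /\
    forall x y z, cyc3 T x y z -> (q, p) \in [:: (x, y); (y, z); (z, x)].
Proof.
move=> hT fT c0; have c1 := cyc3_rot c0; have c2 := cyc3_rot c1.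
have unique u v w : cyc3 T u v w ->
  (exists q p m, cyc3 T q p m /\
    forall x y z, cyc3 T x y z -> (q, p) \in [:: (x, y); (y, z); (z, x)]) \/
  forall d, cyc3 T u v d -> d = w.
  move=> d0; case: (pickP (fun d => cyc3 T u v d && (w != d))) => [d|h].
    case/andP=> d1 wd; left; exists u, v, w; split=> //.
    exact: two_cyc3_share_arc d1 wd.
  by right=> d d1; move: (h d); rewrite d1 => /negbFE/eqP.
(* If [b c] or [c a] lies on a second 3-cycle, that arc is common to all. Otherwise a 3-cycle
   sharing one of them is [a b c] itself, so [a b] is common. *)
case: (unique _ _ _ c1) => // u1; case: (unique _ _ _ c2) => // u2.
exists a, b, c; split=> // x y z d0.
have d1 := cyc3_rot d0; have d2 := cyc3_rot d1.
have := cyc3_share hT fT c0 d0; rewrite /= !inE orbF.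
by case/or3P=> /or3P[] /eqP[e f]; subst; rewrite ?eqxx ?orbT //;
  first [rewrite -(u1 _ d0)|rewrite -(u1 _ d1)|rewrite -(u1 _ d2)
        |rewrite -(u2 _ d0)|rewrite -(u2 _ d1)|rewrite -(u2 _ d2)];
  rewrite eqxx ?orbT.
Qed.

Theorem theorem19 (V : finType) (T : rel V) (hT : irreflexive_tournament T) :
  strongly_chordal T <->
  ~ contains_induced T T1 /\ ~ contains_induced T T2 /\
  ~ contains_induced T T3 /\ ~ contains_induced T T4 /\
  ~ contains_induced T T5 /\ ~ contains_induced T T6.
Proof.
split=> [|fT]; first exact: strongly_chordal_avoids.
case: (pickP (fun t => cyc3 T t.1.1 t.1.2 t.2)) => [[[a b] c] /= abc|nc].
  have [q [p [m [qpm all_qp]]]] := cyc3_common_arc hT fT abc.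
  have qp : T q p by case/and3P: qpm.
  have pNq : p != q by apply/eqP/nesym/(tournament_neq hT qp).
  have [r [rI rP]] := acyclic_rank (flip_tournament hT pNq)
    (flip_acyclic hT qpm all_qp).
  apply: (flipped_strongly_chordal hT rI _ qp rP); rewrite -rP /flip eqxx.
  by rewrite xpair_eqE (negPf pNq).
have [|r [rI rP]] := acyclic_rank hT.
  by move=> x y z; rewrite (nc (x, y, z)).
(* Without 3-cycles the order from sink to source works: [r l < r i < r j]. *)
apply/strongly_chordalP; exists r; split=> // i j k l ij kl; rewrite !rP; lia.
Qed.
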